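(* Fix $\tau,\iota\in(0,1)$ and $\kappa>0$. For each $n$, let $\{(Y_i,\mathbf{X}_i)\}_{i=1}^n$ be i.i.d. copies of $(Y,\mathbf{X})$, where $Y$ is a continuous real random variable and $\mathbf{X}=(X_1,\dots,X_{p_n})^T$ has continuous real components. Suppose that: (C1) in a neighbourhood of $F_Y^{-1}(\tau)$, the density $f_Y$ of $Y$ is uniformly bounded away from zero and infinity and has bounded derivative; and for every $1\le j\le p_n$, in a neighbourhood of $F_{X_j}^{-1}(\iota)$, the density $f_{X_j}$ of $X_j$ is uniformly bounded away from zero and infinity and has bounded derivative (neighbourhood radius and bounds uniform in $j$ and $n$). (i) For any constant $C>0$ there exists a constant $\tilde c_1>0$ such that, for all sufficiently large $n$, $$P\Big(\max_{1\le j\le p_n}|\widehat u_j-u_j|\ge Cn^{-\kappa}\Big)\le 6p_n\exp(-\tilde c_1 n^{1-2\kappa}).$$ (ii) Suppose in addition that (C2) $\min_{j\in\mathcal{M}_a^*}u_j\ge C_0n^{-\kappa}$ for some constant $C_0>0$ (with the same $\kappa$), and choose the threshold $\nu_n=C_1n^{-\kappa}$ with a constant $C_1\le C_0/2$. Then there is a constant $\tilde c_1>0$ such that, for all sufficiently large $n$, $$P\big(\mathcal{M}_a^*\subset\widehat{\mathcal{M}}_a\big)\ge 1-6s_n\exp(-\tilde c_1n^{1-2\kappa}),$$ where $s_n=|\mathcal{M}_a^*|$ is the cardinality of $\mathcal{M}_a^*$.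
   Context: For a CDF $F$, $F^{-1}(\tau)=\inf\{x:F(x)\ge\tau\}$; $F_Y,F_{X_j}$ are the CDFs of $Y,X_j$, $F_{Y,X_j}$ is the joint CDF of $(Y,X_j)$, and $F_{n,Y}^{-1},F_{n,X_j}^{-1}$ are the quantile functions of the empirical CDFs. Let $\psi_\tau(u)=\tau-I(u\le 0)$. The copula-based correlation and its estimator are $$\varrho_{Y,X_j}(\tau,\iota)=\frac{F_{Y,X_j}(F_Y^{-1}(\tau),F_{X_j}^{-1}(\iota))-\tau\iota}{\sqrt{\tau(1-\tau)\iota(1-\iota)}},$$ $$\widehat\varrho_{Y,X_j}(\tau,\iota)=\frac{n^{-1}\sum_{i=1}^n\psi_\tau(Y_i-F_{n,Y}^{-1}(\tau))\,\psi_\iota(X_{ij}-F_{n,X_j}^{-1}(\iota))}{\sqrt{\tau(1-\tau)\iota(1-\iota)}}.$$ Put $u_j=|\varrho_{Y,X_j}(\tau,\iota)|$ and $\widehat u_j=|\widehat\varrho_{Y,X_j}(\tau,\iota)|$. The true active set is $\mathcal{M}_a^*=\{1\le j\le p_n:u_j>0\}$ and the screened set is $\widehat{\mathcal{M}}_a=\{1\le j\le p_n:\widehat u_j\ge\nu_n\}$. The number of predictors $p_n$ may depend on $n$. *)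

(* Defs.v *)
From HB Require Import structures.
From mathcomp Require Import all_boot all_order all_algebra.
From mathcomp Require Import all_classical all_reals all_analysis.

Set Implicit Arguments.
Unset Strict Implicit.
Unset Printing Implicit Defensive.

Import Order.TTheory GRing.Theory Num.Theory.
Import numFieldNormedType.Exports.

Local Open Scope classical_set_scope.
Local Open Scope ring_scope.

(* [inf] is total on [set R]; the infimum is a genuine one for [0 < tau < 1]
   and [F] a (possibly empirical) cdf. *)
Definition quantile (R : realType) (F : R -> R) (tau : R) : R :=
  inf [set x | tau <= F x].

Definition rcdf d (T : measurableType d) (R : realType) (P : probability T R)
    (X : {RV P >-> R}) (x : R) : R :=
  fine (cdf X x).

Definition joint_cdf d (T : measurableType d) (R : realType)
    (P : probability T R) (X1 X2 : {RV P >-> R}) (x1 x2 : R) : R :=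
  fine (P [set w | X1 w <= x1 /\ X2 w <= x2]).

Definition empirical_cdf (R : realType) (n : nat) (a : 'I_n -> R) (x : R) : R :=
  n%:R^-1 * \sum_(i < n) (a i <= x)%R%:R.

Definition psi (R : realType) (tau u : R) : R := tau - (u <= 0)%R%:R.

Definition copula_corr d (T : measurableType d) (R : realType)
    (P : probability T R) (tau iota : R) (Y X : {RV P >-> R}) : R :=
  (joint_cdf Y X (quantile (rcdf Y) tau) (quantile (rcdf X) iota) - tau * iota)
  / Num.sqrt (tau * (1 - tau) * iota * (1 - iota)).

Definition copula_corr_hat (R : realType) (tau iota : R) (n : nat)
    (y x : 'I_n -> R) : R :=
  (n%:R^-1 * \sum_(i < n)
     psi tau (y i - quantile (empirical_cdf y) tau) *
     psi iota (x i - quantile (empirical_cdf x) iota))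
  / Num.sqrt (tau * (1 - tau) * iota * (1 - iota)).

Definition utility d (T : measurableType d) (R : realType)
    (P : probability T R) (tau iota : R) (p : nat)
    (Y : {RV P >-> R}) (X : 'I_p -> {RV P >-> R}) (j : 'I_p) : R :=
  `|copula_corr tau iota Y (X j)|.

(* [Ys i] and [Xs i j] are the observations Y_i and X_ij, [w] the outcome. *)
Definition utility_hat d (T : measurableType d) (R : realType)
    (P : probability T R) (tau iota : R) (n p : nat)
    (Ys : 'I_n -> {RV P >-> R}) (Xs : 'I_n -> 'I_p -> {RV P >-> R})
    (j : 'I_p) (w : T) : R :=
  `|copula_corr_hat tau iota (fun i => Ys i w) (fun i => Xs i j w)|.

Definition active_set d (T : measurableType d) (R : realType)
    (P : probability T R) (tau iota : R) (p : nat)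
    (Y : {RV P >-> R}) (X : 'I_p -> {RV P >-> R}) : {set 'I_p} :=
  [set j | 0 < utility tau iota Y X j]%SET.

Definition screened_set d (T : measurableType d) (R : realType)
    (P : probability T R) (tau iota nu : R) (n p : nat)
    (Ys : 'I_n -> {RV P >-> R}) (Xs : 'I_n -> 'I_p -> {RV P >-> R})
    (w : T) : {set 'I_p} :=
  [set j | nu <= utility_hat tau iota Ys Xs j w]%SET.

Definition response_covariates d (T : measurableType d) (R : realType)
    (P : probability T R) (p : nat)
    (Y : {RV P >-> R}) (X : 'I_p -> {RV P >-> R}) (w : T) :
    (R * p.-tuple R)%type :=
  (Y w, [tuple X j w | j < p]).

Definition identically_distributed d d' (T : measurableType d)
    (E : measurableType d') (R : realType) (P : probability T R)
    (Z1 Z2 : T -> E) : Prop :=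
  forall A : set E, measurable A -> P (Z1 @^-1` A) = P (Z2 @^-1` A).

Definition mutually_independent d d' (T : measurableType d)
    (E : measurableType d') (R : realType) (P : probability T R)
    (I : finType) (Z : I -> T -> E) : Prop :=
  forall (J : {set I}) (A : I -> set E), (forall i, measurable (A i)) ->
    P (\bigcap_(i in [set` J]) Z i @^-1` A i) =
    (\prod_(i in J) P (Z i @^-1` A i))%E.

Definition iid_copies d (T : measurableType d) (R : realType)
    (P : probability T R) (n p : nat)
    (Y : {RV P >-> R}) (X : 'I_p -> {RV P >-> R})
    (Ys : 'I_n -> {RV P >-> R}) (Xs : 'I_n -> 'I_p -> {RV P >-> R}) : Prop :=
  mutually_independent P (fun i => response_covariates (Ys i) (Xs i)) /\
  forall i, identically_distributed P
    (response_covariates (Ys i) (Xs i)) (response_covariates Y X).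

(* A continuous random variable is one whose cdf is continuous; a density is
   only asked for locally, by [density_on]. *)
Definition continuous_rv d (T : measurableType d) (R : realType)
    (P : probability T R) (X : {RV P >-> R}) : Prop :=
  continuous (rcdf X).

Definition density_on d (T : measurableType d) (R : realType)
    (P : probability T R) (X : {RV P >-> R}) (B : set R) (f : R -> R) : Prop :=
  forall A : set R, measurable A -> A `<=` B ->
    distribution P X A = (\int[lebesgue_measure]_(x in A) (f x)%:E)%E.

Definition regular_density_near_quantile d (T : measurableType d)
    (R : realType) (P : probability T R) (r m M D tau : R)
    (X : {RV P >-> R}) : Prop :=
  let B : set R := ball (quantile (rcdf X) tau) r in
  exists2 f : R -> R, density_on X B f &
    forall x : R, B x -> [/\ m <= f x <= M, derivable f x 1 & `|derive1 f x| <= D].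

(* Main.v *)
(** Let [q], [q'] be the population quantiles and [q_n], [q'_n] the empirical
    ones.  Almost surely the observations have no ties, so the empirical cdf
    [F_n] satisfies [tau <= F_n(q_n) <= tau + 1/n]; as indicators of half-lines
    are nested, [|F_n(q_n) - F_n(q)| <= |F_n(q) - tau| + 1/n].  Hence the
    numerator of the estimator differs from its population value by at most
    [4/n] plus three deviations of empirical frequencies from their means: of
    [{Y <= q}], of [{X_j <= q'}] and of their intersection.  Each obeys a
    two-sided exponential (Chernoff) bound with factor [2], which gives the
    factor [6]; a union bound over the predictors concludes. *)

Require Import Defs.
From HB Require Import structures.
From mathcomp Require Import all_boot all_order all_algebra.
From mathcomp Require Import all_classical all_reals all_analysis.
From mathcomp Require Import measurable_realfun ring lra.

Set Implicit Arguments.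
Unset Strict Implicit.
Unset Printing Implicit Defensive.

Import Order.TTheory GRing.Theory Num.Theory.
Import numFieldNormedType.Exports.

Local Open Scope classical_set_scope.
Local Open Scope ring_scope.

(** * Empirical cdfs, their quantiles, and the sample copula moment *)

Section empirical.
Variables (R : realType) (n : nat).
Implicit Types (y x : 'I_n -> R) (tau iota q : R).

Lemma empirical_cdf_eq1 y q :
  (0 < n)%N -> (forall i, y i <= q) -> empirical_cdf y q = 1.
Proof.
move=> n0 yq; rewrite /empirical_cdf (eq_bigr (fun=> 1)) => [|i _]; last first.
  by rewrite yq.
by rewrite sumr_const card_ord mulVf// pnatr_eq0 -lt0n.
Qed.

Lemma empirical_cdf_ub y : exists M, forall i, `|y i| <= M.
Proof.
exists (\sum_i `|y i|) => i.
by rewrite (bigD1 i)//= lerDl sumr_ge0.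
Qed.

(* Rephrasing the comparison with ranks makes it a measurable function of the
   sample. *)
Lemma le_quantile_empirical y tau (i : 'I_n) : 0 < tau <= 1 ->
  (y i <= quantile (empirical_cdf y) tau) =
  (n%:R^-1 * \sum_(k < n) (y k < y i)%R%:R < tau).
Proof.
move=> /andP[t0 t1].
have n0 : (0 < n)%N by apply: leq_ltn_trans (ltn_ord i).
have nV : 0 <= n%:R^-1 :> R by rewrite invr_ge0.
have [M yM] := empirical_cdf_ub y.
set S := [set z | tau <= empirical_cdf y z].
apply/idP/idP => [yq|rt]; last first.
  apply: lb_le_inf.
    exists M; rewrite /= empirical_cdf_eq1// => k.
    by rewrite (le_trans (ler_norm _)).
  move=> z /= tz; rewrite leNgt; apply/negP => zy.
  move: rt; rewrite ltNge => /negP; apply; apply: le_trans tz _.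
  apply: ler_wpM2l => //; apply: ler_sum => k _.
  by case: (leP (y k) z) => //= ykz; rewrite (le_lt_trans ykz).
rewrite ltNge; apply/negP => tr.
have [k0 k0i] : exists k0, y k0 < y i.
  apply: contrapT => /forallNP nk; move: (lt_le_trans t0 tr).
  rewrite big1 ?mulr0 ?ltxx// => k _.
  by case: (ltP (y k) (y i)) => // /nk.
(* The largest observation [y m] strictly below [y i] already reaches level [tau], so the infimum is
   at most [y m], against [yq]. *)
have [m ym mP] := @Order.TotalTheory.arg_maxP _ _ _ k0
  (fun k => y k < y i) y k0i.
have mS : S (y m).
  apply: le_trans tr _; apply: ler_wpM2l => //; apply: ler_sum => k _.
  by case: (ltP (y k) (y i)) => //= /mP/= ykm; rewrite ykm.
(* [inf] is a lower bound only for a set bounded below; [0 < tau] ensures this, as the empirical cdf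
   vanishes left of the sample. *)
have lbS : has_lbound S.
  exists (- M) => z /= tz; rewrite leNgt; apply/negP => zM.
  move: (lt_le_trans t0 tz); rewrite /empirical_cdf.
  rewrite big1 ?mulr0 ?ltxx// => k _.
  case: (leP (y k) z) => // ykz; have := yM k.
  by rewrite ler_norml => /andP[/(lt_le_trans zM)]; rewrite ltNge ykz.
have := ge_inf lbS mS; rewrite -/(quantile _ _) => /(le_trans yq).
by rewrite leNgt ym.
Qed.

(** The infimum is attained. Otherwise take the smallest observation beyond the quantile: everything
    strictly below it lies at or below the quantile, so its rank fraction stays under [tau], and
    [le_quantile_empirical] puts it back at or below the quantile. *)
Lemma empirical_cdf_quantile_ge y tau : (0 < n)%N -> 0 < tau <= 1 ->
  tau <= empirical_cdf y (quantile (empirical_cdf y) tau).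
Proof.
move=> n0 t01; set q := quantile _ _.
rewrite leNgt; apply/negP => Ft.
have [i0 i0q] : exists i, q < y i.
  apply: contrapT => /forallNP ni; move: Ft.
  rewrite empirical_cdf_eq1// => [|i]; first by rewrite ltNge (andP t01).2.
  by rewrite leNgt; apply/negP/ni.
have [i iq iP] := @Order.TotalTheory.arg_minP _ _ _ i0
  (fun k => q < y k) y i0q.
move: iq; rewrite ltNge => /negP; apply.
rewrite le_quantile_empirical//; apply: le_lt_trans Ft.
apply: ler_wpM2l; first by rewrite invr_ge0.
apply: ler_sum => k _; case: (ltP (y k) (y i)) => // yki.
by case: (leP (y k) q) => // /iP; rewrite leNgt yki.
Qed.

(** The largest observation not exceeding the quantile has a strict rank fraction below [tau];
    without ties, counting that observation too adds only [1/n]. *)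
Lemma empirical_cdf_quantile_le y tau : injective y -> 0 < tau <= 1 ->
  empirical_cdf y (quantile (empirical_cdf y) tau) <= tau + n%:R^-1.
Proof.
move=> yI t01; set q := quantile _ _.
have nV : 0 <= n%:R^-1 :> R by rewrite invr_ge0.
have t0 : 0 <= tau by case/andP: t01 => /ltW.
have [[i0 i0q]|nq] := pselect (exists i, y i <= q); last first.
  rewrite /empirical_cdf big1 ?mulr0 ?addr_ge0// => i _.
  by case: (leP (y i) q) => // iq; case: nq; exists i.
have [i iq iP] := @Order.TotalTheory.arg_maxP _ _ _ i0
  (fun k => y k <= q) y i0q.
have := iq; rewrite le_quantile_empirical// => ri.
apply: (@le_trans _ _
    (n%:R^-1 * (\sum_(k < n) (y k < y i)%R%:R + \sum_(k < n) (k == i)%:R))).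
  rewrite -big_split/=; apply: ler_wpM2l => //; apply: ler_sum => k _.
  case: (leP (y k) q) => [/iP/= yki|_]; last by rewrite addr_ge0.
  by move: yki; rewrite le_eqVlt => /predU1P[/yI ->|->]; rewrite ?eqxx
    ?lerDl ?lerDr.
rewrite [X in _ + X](bigD1 i)//= eqxx [X in 1 + X]big1 ?addr0; last first.
  by move=> k /negbTE ->.
by rewrite mulrDr mulr1 lerD2r ltW.
Qed.

(** Half-lines are nested, so all differences have the same sign and nothing cancels. *)
Lemma sum_norm_indicator_diff y q q' :
  \sum_(i < n) `|(y i <= q)%R%:R - (y i <= q')%R%:R| =
  `|\sum_(i < n) (y i <= q)%R%:R - \sum_(i < n) (y i <= q')%R%:R| :> R.
Proof.
wlog qq : q q' / q <= q'.
  move=> H; have [/H//|/ltW/H] := leP q q'; rewrite distrC => <-.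
  by apply: eq_bigr => i _; rewrite distrC.
have le i : (y i <= q)%R%:R <= (y i <= q')%R%:R :> R.
  by case: (leP (y i) q) => // yq; rewrite (le_trans yq).
rewrite distrC ger0_norm ?subr_ge0 ?ler_sum// -sumrB.
by apply: eq_bigr => i _; rewrite distrC ger0_norm ?subr_ge0.
Qed.

Definition empirical_joint_cdf y x q q' : R :=
  n%:R^-1 * \sum_(i < n) ((y i <= q) && (x i <= q'))%R%:R.

(** A product of two indicators changes by at most the sum of the changes of its factors;
    [sum_norm_indicator_diff] then collapses the two sums of absolute changes. *)
Lemma empirical_joint_cdf_dist y x q1 q2 q1' q2' :
  `|empirical_joint_cdf y x q1 q2 - empirical_joint_cdf y x q1' q2'| <=
  `|empirical_cdf y q1 - empirical_cdf y q1'| +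
  `|empirical_cdf x q2 - empirical_cdf x q2'|.
Proof.
have nV : 0 <= n%:R^-1 :> R by rewrite invr_ge0.
rewrite /empirical_joint_cdf /empirical_cdf -!mulrBr !normrM -mulrDr.
rewrite -!sum_norm_indicator_diff; apply: ler_wpM2l => //.
rewrite -sumrB; apply: le_trans (ler_norm_sum _ _ _) _.
rewrite -big_split/=; apply: ler_sum => i _.
case: (y i <= q1); case: (x i <= q2); case: (y i <= q1'); case: (x i <= q2');
  rewrite /= ?(subrr, subr0, sub0r, normrN, normr0, normr1) ?addr0 ?add0r//;
  by rewrite ?ler0n// ?lerDl.
Qed.

Lemma mean_psi_product y x tau iota q q' : (0 < n)%N ->
  n%:R^-1 * \sum_(i < n) psi tau (y i - q) * psi iota (x i - q') =
  tau * iota - tau * empirical_cdf x q' - iota * empirical_cdf y q +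
  empirical_joint_cdf y x q q'.
Proof.
move=> n0; have nN0 : n%:R != 0 :> R by rewrite pnatr_eq0 -lt0n.
rewrite /empirical_cdf /empirical_joint_cdf.
rewrite (eq_bigr (fun i => tau * iota - tau * (x i <= q')%R%:R
    - iota * (y i <= q)%R%:R + ((y i <= q) && (x i <= q'))%R%:R)); last first.
  move=> i _; rewrite /psi !subr_le0.
  by case: (y i <= q); case: (x i <= q') => /=; ring.
rewrite big_split/= !sumrB -!mulr_sumr sumr_const card_ord -mulr_natl.
by field.
Qed.

(** Trades the random quantiles for fixed points [q0], [q1]: what remains are frequencies of fixed
    events, to which tail bounds for independent observations apply. *)
Lemma copula_moment_dist y x tau iota q0 q1 J0 : (0 < n)%N ->
    0 < tau < 1 -> 0 < iota < 1 -> injective y -> injective x ->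
  `|n%:R^-1 * (\sum_(i < n)
      psi tau (y i - quantile (empirical_cdf y) tau) *
      psi iota (x i - quantile (empirical_cdf x) iota)) - (J0 - tau * iota)|
  <= `|empirical_joint_cdf y x q0 q1 - J0| + `|empirical_cdf y q0 - tau| +
     `|empirical_cdf x q1 - iota| + 4 * n%:R^-1.
Proof.
move=> n0 /andP[t0 t1] /andP[i0 i1] yI xI; rewrite mean_psi_product//.
have t01 : 0 < tau <= 1 by rewrite t0 ltW.
have i01 : 0 < iota <= 1 by rewrite i0 ltW.
set q := quantile (empirical_cdf y) tau.
set q' := quantile (empirical_cdf x) iota.
have := empirical_cdf_quantile_ge y n0 t01.
have := empirical_cdf_quantile_le yI t01.
have := empirical_cdf_quantile_ge x n0 i01.
have := empirical_cdf_quantile_le xI i01.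
have := empirical_joint_cdf_dist y x q q' q0 q1.
rewrite -/q -/q'.
move: (empirical_cdf y q) (empirical_cdf x q') (empirical_cdf y q0)
  (empirical_cdf x q1) => a b a0 b0.
move: (empirical_joint_cdf y x q q') (empirical_joint_cdf y x q0 q1) => J Jq.
have : 0 <= n%:R^-1 :> R by rewrite invr_ge0.
move: (n%:R^-1) => v v0 hJ hb1 hb0 ha1 ha0.
have hb : `|b - iota| <= v by rewrite ler_norml; apply/andP; split; lra.
have ha : `|a - tau| <= v by rewrite ler_norml; apply/andP; split; lra.
(* Moving the joint frequency to [q0], [q1] costs [2/n] plus the two marginal deviations; the last
   two terms cost [1/n] each, whence [4/n]. *)
have -> : tau * iota - tau * b - iota * a + J - (J0 - tau * iota) =
  (J - Jq) + (Jq - J0) + (- (tau * (b - iota)) + - (iota * (a - tau))) by ring.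
have aa0 : `|a - a0| <= v + `|a0 - tau|.
  by rewrite (le_trans (ler_distD tau _ _))// lerD// distrC.
have bb0 : `|b - b0| <= v + `|b0 - iota|.
  by rewrite (le_trans (ler_distD iota _ _))// lerD// distrC.
have h1 : `|- (tau * (b - iota))| <= v.
  rewrite normrN normrM gtr0_norm// -[leRHS]mul1r.
  by apply: ler_pM => //; exact: ltW.
have h2 : `|- (iota * (a - tau))| <= v.
  rewrite normrN normrM gtr0_norm// -[leRHS]mul1r.
  by apply: ler_pM => //; exact: ltW.
apply: le_trans (ler_normD _ _) _.
have := ler_normD (J - Jq) (Jq - J0).
have := ler_normD (- (tau * (b - iota))) (- (iota * (a - tau))).
lra.
Qed.

End empirical.

(** * Chernoff bound for Bernoulli weights on finite patterns *)

Section bernoulli_tail.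
Variable R : realType.

(** Inverting [1 - x <= expR (- x)] bounds [expR x] by [1 / (1 - x)], and [(1 + x + 2 x^2) (1 - x) =
    1 + x^2 (1 - 2 x)] is at least 1 in this range. *)
Lemma expR_le_quadratic (x : R) :
  `|x| <= 1 / 2 -> expR x <= 1 + x + 2 * x ^+ 2.
Proof.
rewrite ler_norml => /andP[x1 x2].
have e : 1 - x <= expR (- x) by exact: expR_ge1Dx.
have x10 : 0 < 1 - x by lra.
have : expR x <= (1 - x)^-1.
  by rewrite -[expR x]invrK -expRN lef_pV2// posrE expR_gt0.
move=> /le_trans; apply.
rewrite -div1r ler_pdivrMr//.
have : 0 <= x ^+ 2 * (1 - 2 * x) by rewrite mulr_ge0// ?sqr_ge0//; lra.
lra.
Qed.

Let weight (p : R) (c : bool) := if c then p else 1 - p.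

(** Centring cancels the linear terms of the quadratic bound and leaves [1 + 2 t^2]. *)
Lemma bernoulli_mgf (p t : R) : 0 <= p <= 1 -> 0 <= t <= 1 / 2 ->
  \sum_(c : bool) weight p c * expR (t * (c%:R - p)) <= expR (2 * t ^+ 2).
Proof.
move=> /andP[p0 p1] /andP[t0 t1]; rewrite big_bool/= sub0r.
have b z : `|z| <= 1 -> expR (t * z) <= 1 + t * z + 2 * t ^+ 2.
  move=> z1.
  have tz : `|t * z| <= t by rewrite normrM (ger0_norm t0) ler_piMr.
  apply: le_trans (expR_le_quadratic (le_trans tz t1)) _.
  rewrite lerD2l ler_wpM2l// -(real_normK (num_real (t * z))).
  by rewrite ler_pXn2r// nnegrE.
have b1 : `|1 - p| <= 1 by rewrite ler_norml; lra.
have b2 : `|- p| <= 1 by rewrite ler_norml; lra.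
apply: (@le_trans _ _ (1 + 2 * t ^+ 2)); last exact: expR_ge1Dx.
have p'0 : 0 <= 1 - p by lra.
apply: le_trans (lerD (ler_wpM2l p0 (b _ b1)) (ler_wpM2l p'0 (b _ b2))) _.
lra.
Qed.

(** Multiplying the weight of a bad pattern with centred sum [S] by [expR (t (S - eps n))] can only
    increase it; the sum of these products over all patterns factors into [n] equal moment
    generating functions. *)
Lemma bernoulli_chernoff (n : nat) (p eps : R) :
    0 <= p <= 1 -> 0 < eps <= 2 ->
  \sum_(b : {ffun 'I_n -> bool} |
      eps * n%:R <= \sum_(i < n) ((b i)%:R - p)) \prod_(i < n) weight p (b i)
  <= expR (- (eps ^+ 2 / 8) * n%:R).
Proof.
move=> p01 /andP[e0 e2]; have /andP[p0 p1] := p01.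
(* This [t] minimises [2 t^2 - t eps], with value [- eps^2 / 8]; [eps <= 2] keeps it in the range of
   [bernoulli_mgf]. *)
pose t := eps / 4.
have t0 : 0 <= t by rewrite /t; lra.
have t12 : 0 <= t <= 1 / 2 by rewrite /t; lra.
have w0 c : 0 <= weight p c by case: c; rewrite /weight; lra.
pose mgf := \sum_(c : bool) weight p c * expR (t * (c%:R - p)).
apply: (@le_trans _ _ (expR (- t * (eps * n%:R)) * mgf ^+ n)); last first.
  have mgf0 : 0 <= mgf.
    by apply: sumr_ge0 => c _; rewrite mulr_ge0// expR_ge0.
  have /(lerXn2r n) := bernoulli_mgf p01 t12.
  rewrite !nnegrE => /(_ mgf0 (expR_ge0 _)).
  rewrite -expRM_natl => /(ler_wpM2l (expR_ge0 (- t * (eps * n%:R)))).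
  move=> /le_trans; apply; rewrite -expRD ler_expR /t le_eqVlt; apply/orP; left.
  by apply/eqP; field.
have -> : mgf ^+ n = \sum_(b : {ffun 'I_n -> bool})
    \prod_(i < n) (weight p (b i) * expR (t * ((b i)%:R - p))).
  by rewrite -(bigA_distr_bigA (fun (i : 'I_n) c =>
    weight p c * expR (t * (c%:R - p)))) prodr_const card_ord.
rewrite mulr_sumr big_mkcond/=; apply: ler_sum => b _.
have pw0 : 0 <= \prod_(i < n) weight p (b i) by exact: prodr_ge0.
rewrite [\prod_(i < n) (_ * _)]big_split/= -expR_sum -mulr_sumr mulrCA -expRD.
case: ifPn => [bad|_]; last by rewrite mulr_ge0// expR_ge0.
rewrite ler_peMr// -[leLHS]expR0 ler_expR mulNr addrC -mulrBr mulr_ge0//.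
by rewrite subr_ge0.
Qed.

End bernoulli_tail.

(** * Finite union bounds and measurable level sets *)

Lemma measure_bigsetU_le d (T : measurableType d) (R : realType)
    (mu : {measure set T -> \bar R}) (I : Type) (r : seq I) (Q : pred I)
    (F : I -> set T) : (forall i, measurable (F i)) ->
  (mu (\big[setU/set0]_(i <- r | Q i) F i) <=
   \sum_(i <- r | Q i) mu (F i))%E.
Proof.
move=> mF; elim: r => [|i r ih]; first by rewrite !big_nil measure0.
rewrite !big_cons; case: ifP => // _.
apply: le_trans (measureU2 mu (mF i) _) _; first exact: bigsetU_measurable.
exact: leeD2l.
Qed.

Lemma measure_fin_cover_le d (T : measurableType d) (R : realType)
    (mu : {measure set T -> \bar R}) (I : finType) (Q : pred I)
    (F : I -> set T) (A : set T) : measurable A ->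
    (forall i, measurable (F i)) ->
    (forall w, A w -> exists2 i, Q i & F i w) ->
  (mu A <= \sum_(i | Q i) mu (F i))%E.
Proof.
move=> mA mF AF; apply: le_trans (measure_bigsetU_le mu _ _ mF).
apply: le_measure; rewrite ?inE//; first exact: bigsetU_measurable.
move=> w /AF[i Qi Fiw]; rewrite -bigcup_seq_cond/=; exists i => //=.
by rewrite mem_index_enum.
Qed.

Lemma measurable_superlevel d (T : measurableType d) (R : realType)
    (f : T -> R) (c : R) : measurable_fun setT f ->
  measurable [set w | c <= f w].
Proof.
by move=> mf; rewrite -[X in measurable X]setTI -preimage_itvcy; exact: mf.
Qed.

(** * Deviation of an empirical frequency from its probability *)

Section hoeffding.
Context d d' (T : measurableType d) (E : measurableType d') (R : realType).
Variables (P : probability T R) (n : nat) (Z : 'I_n -> T -> E).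
Hypothesis mZ : forall i, measurable_fun setT (Z i).
Hypothesis indZ : mutually_independent P Z.

Lemma measurable_empirical_deviation (B : set E) (p c : R) : measurable B ->
  measurable [set w | c <= \sum_(i < n) (\1_B (Z i w) - p)].
Proof.
move=> mB; apply: measurable_superlevel; apply: measurable_sum => i.
apply: measurable_funB => //.
by apply: measurableT_comp => //; exact: measurable_indic.
Qed.

(** The event is covered by the membership patterns of the observations in [B]; independence gives
    each pattern its product weight, which reduces the claim to [bernoulli_chernoff]. *)
Lemma empirical_upper_deviation (B : set E) (p eps : R) :
    measurable B -> (forall i, P (Z i @^-1` B) = p%:E) -> 0 <= p <= 1 ->
    0 < eps <= 2 ->
  (P [set w | (eps * n%:R <= \sum_(i < n) (\1_B (Z i w) - p))%R]
   <= (expR (- (eps ^+ 2 / 8) * n%:R))%:E)%E.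
Proof.
move=> mB PB p01 e02.
pose S (c : bool) := if c then B else ~` B.
have mS c : measurable (S c) by case: c => //; exact: measurableC.
pose F (b : {ffun 'I_n -> bool}) := \bigcap_(i in [set` [set: 'I_n]%SET])
  (Z i @^-1` (S (b i))).
have mZS i c : measurable (Z i @^-1` S c).
  by rewrite -[X in measurable X]setTI; exact: mZ.
have mF b : measurable (F b).
  by apply: fin_bigcap_measurable => // i _.
have PS i c : P (Z i @^-1` S c) = (if c then p else 1 - p)%:E.
  case: c => //=; rewrite preimage_setC probability_setC ?PB//.
  exact: (mZS i true).
have PF b : P (F b) = (\prod_(i < n) (if b i then p else 1 - p))%:E.
  rewrite /F (indZ [set: 'I_n]%SET (fun i => mS (b i))).
  under eq_bigl do rewrite finset.in_setT.
  by rewrite -prodEFin; apply: eq_bigr => i _; exact: PS.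
apply: le_trans (measure_fin_cover_le (Q := fun b : {ffun 'I_n -> bool} =>
   eps * n%:R <= \sum_(i < n) ((b i)%:R - p)) P _ mF _) _.
- exact: measurable_empirical_deviation.
- move=> w /= dev; exists [ffun i => Z i w \in B].
    apply: le_trans dev _; apply: ler_sum => i _.
    by rewrite ffunE.
  move=> i _ /=; rewrite /S ffunE; case: ifPn; first by rewrite inE.
  by rewrite notin_setE.
rewrite (eq_bigr _ (fun b _ => PF b)).
by rewrite sumEFin lee_fin; exact: bernoulli_chernoff.
Qed.

(** The lower tail for [B] is the upper tail for its complement, the centred indicators being
    opposite. *)
Lemma empirical_deviation (B : set E) (p eps : R) :
    measurable B -> (forall i, P (Z i @^-1` B) = p%:E) -> 0 <= p <= 1 ->
    0 < eps <= 2 ->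
  (P [set w | (eps * n%:R <= `|\sum_(i < n) (\1_B (Z i w) - p)|)%R]
   <= (2 * expR (- (eps ^+ 2 / 8) * n%:R))%:E)%E.
Proof.
move=> mB PB p01 e02.
have mC : measurable (~` B) by exact: measurableC.
have PC i : P (Z i @^-1` (~` B)) = (1 - p)%:E.
  rewrite preimage_setC probability_setC ?PB//.
  by rewrite -[X in measurable X]setTI; exact: mZ.
have p01' : 0 <= 1 - p <= 1 by move: p01 => /andP[? ?]; apply/andP; split; lra.
have -> : [set w | (eps * n%:R <= `|\sum_(i < n) (\1_B (Z i w) - p)|)%R] =
    [set w | (eps * n%:R <= \sum_(i < n) (\1_B (Z i w) - p))%R] `|`
    [set w | (eps * n%:R <= \sum_(i < n) (\1_(~` B) (Z i w) - (1 - p)))%R].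
  apply/seteqP; split=> w /=.
    rewrite ler_normr => /orP[|h]; [by left|right].
    move: h; rewrite -sumrN => /le_trans; apply; apply: ler_sum => i _.
    rewrite ?indicE in_setC; case: (_ \in B) => /=; lra.
  rewrite ler_normr => -[->//|h]; apply/orP; right.
  move: h; rewrite -sumrN => /le_trans; apply; apply: ler_sum => i _.
  rewrite ?indicE in_setC; case: (_ \in B) => /=; lra.
apply: le_trans (measureU2 P _ _) _.
- exact: measurable_empirical_deviation.
- exact: measurable_empirical_deviation.
rewrite mulr_natl mulr2n EFinD; apply: leeD.
  exact: empirical_upper_deviation.
exact: empirical_upper_deviation.
Qed.

End hoeffding.

(** * Continuous cdfs: exact quantiles, no atoms, no ties *)

Section continuous_cdf.
Context d (T : measurableType d) (R : realType) (P : probability T R).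
Implicit Types X W : {RV P >-> R}.

Lemma rcdf_EFin X x : P (X @^-1` `]-oo, x]) = (rcdf X x)%:E.
Proof. by rewrite /rcdf fineK// fin_num_measure. Qed.

Lemma rcdf_nondecreasing X : {homo rcdf X : x y / x <= y}.
Proof.
move=> x y xy; rewrite /rcdf fine_le ?fin_num_measure//.
exact: cdf_nondecreasing.
Qed.

(** By continuity a strict inequality at [q] persists nearby. A cdf above [tau] at [q] puts a point
    left of [q] in the level set; a cdf below [tau] makes, by monotonicity, a point right of [q] a
    lower bound. Both contradict the infimum. *)
Lemma rcdf_quantile X tau : continuous_rv X -> 0 < tau < 1 ->
  rcdf X (quantile (rcdf X) tau) = tau.
Proof.
move=> cX /andP[t0 t1]; set q := quantile _ _.
pose S := [set x | tau <= rcdf X x].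
(* The limits of the cdf at both infinities make [S] nonempty and bounded below, so [inf] is a
   genuine infimum. *)
have S0 : S !=set0.
  have : rcdf X x @[x --> +oo] --> (1 : R) by exact/fine_cvg/cvg_cdfy1.
  by move/cvgr_ge => /(_ _ t1) /filter_ex.
have lbS : has_lbound S.
  have : rcdf X x @[x --> -oo] --> (0 : R) by exact/fine_cvg/cvg_cdfNy0.
  move/cvgr_lt => /(_ _ t0) /filter_ex[x xt].
  exists x => y /= ty; rewrite leNgt; apply/negP => /ltW.
  move=> /(rcdf_nondecreasing X) yx.
  by have := le_lt_trans (le_trans ty yx) xt; rewrite ltxx.
have cq : rcdf X x @[x --> q] --> rcdf X q by exact: cX.
apply/eqP; rewrite eq_le; apply/andP; split; rewrite leNgt; apply/negP => h.
- have /nbhs_ballP[e /= e0 eq_] : nbhs q [set x | tau < rcdf X x]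
    by exact: cvgr_gt _ cq _ h.
  have /eq_/= te : ball q e (q - e / 2).
    rewrite /ball/= opprB addrCA subrr addr0 gtr0_norm ?divr_gt0//.
    by rewrite ltr_pdivrMr// ltr_pMr// ltr1n.
  have /ge_inf : S (q - e / 2) by exact: ltW.
  move=> /(_ lbS); rewrite -[inf _]/q leNgt => /negP; apply.
  by rewrite ltrBlDr ltrDl divr_gt0.
- have /nbhs_ballP[e /= e0 eq_] : nbhs q [set x | rcdf X x < tau]
    by exact: cvgr_lt _ cq _ h.
  have /eq_/= te : ball q e (q + e / 2).
    rewrite /ball/= opprD addNKr normrN gtr0_norm ?divr_gt0//.
    by rewrite ltr_pdivrMr// ltr_pMr// ltr1n.
  suff : q + e / 2 <= q.
    by rewrite leNgt => /negP; apply; rewrite ltrDl divr_gt0.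
  apply: lb_le_inf => // y /= ty; rewrite leNgt; apply/negP => /ltW.
  move=> /(rcdf_nondecreasing X) yx.
  by have := le_lt_trans (le_trans ty yx) te; rewrite ltxx.
Qed.

(** The atom is at most the increment of the cdf between [y - r / 2] and [y], which continuity makes
    arbitrarily small. *)
Lemma continuous_rv_atomless X y : continuous_rv X ->
  P (X @^-1` [set y]) = 0%E.
Proof.
move=> cX.
have mXy : measurable (X @^-1` [set y]).
  by rewrite -[X in measurable X]setTI; exact: measurable_funPT.
have fy : P (X @^-1` [set y]) \is a fin_num by rewrite fin_num_measure.
rewrite -(fineK fy); congr _%:E; apply/eqP.
rewrite eq_le fine_ge0// andbT; apply/ler_addgt0Pr => e e0; rewrite add0r.
have cy : rcdf X x @[x --> y] --> rcdf X y by exact: cX.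
have ye : rcdf X y - e < rcdf X y by rewrite ltrBlDr ltrDl.
have /nbhs_ballP[r /= r0 rP] : nbhs y [set x | rcdf X y - e < rcdf X x]
    by exact: cvgr_gt _ cy _ ye.
have /rP/= h : ball y r (y - r / 2).
  rewrite /ball/= opprB addrCA subrr addr0 gtr0_norm ?divr_gt0//.
  by rewrite ltr_pdivrMr// ltr_pMr// ltr1n.
have mle z : measurable (X @^-1` `]-oo, z]).
  by rewrite -[X in measurable X]setTI; exact: measurable_funPT.
have : (P (X @^-1` [set y]) + P (X @^-1` `]-oo, (y - r / 2)%R]) <=
    P (X @^-1` `]-oo, y]))%E.
  rewrite -measureU//; last first.
    apply/seteqP; split => // w /= [->]; rewrite in_itv/= leNgt => /negP; apply.
    by rewrite ltrBlDr ltrDl divr_gt0.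
  apply: le_measure; rewrite ?inE//; first exact: measurableU.
  move=> w /= [->|]; rewrite in_itv/= ?in_itv//= => /le_trans; apply.
  by rewrite lerBlDr lerDl divr_ge0// ltW.
rewrite !rcdf_EFin -(fineK fy) -EFinD lee_fin; move: h; lra.
Qed.

(** Independence makes the joint law a product measure; the sections of the diagonal are singletons,
    null for the law of [W2]. *)
Lemma independent_ties_null W1 W2 : continuous_rv W2 ->
    (forall A B, measurable A -> measurable B ->
      P (W1 @^-1` A `&` W2 @^-1` B) =
      (P (W1 @^-1` A) * P (W2 @^-1` B))%E) ->
  P [set w | W1 w = W2 w] = 0%E.
Proof.
move=> cW2 indW.
have mW : measurable_fun setT (fun w => (W1 w, W2 w)).
  by apply: measurable_fun_pair; exact: measurable_funPT.
pose W : {RV P >-> (R * R)%type} := mfun_Sub (mem_set mW).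
pose D : set (R * R) := [set z | z.1 = z.2].
have mD : measurable D.
  have -> : D = (fun z : R * R => z.1 == z.2) @^-1` [set true].
    by apply/seteqP; split=> z /= /eqP.
  rewrite -[X in measurable X]setTI.
  exact: (measurable_fun_eqr measurable_fst measurable_snd).
have -> : [set w | W1 w = W2 w] = W @^-1` D by [].
transitivity ((distribution P W1 \x distribution P W2)%E D).
  apply/esym/(@product_measure_unique _ _ _ _ _ _ _ (distribution P W)) => //.
rewrite /product_measure1 integral0_eq// => x _ /=.
rewrite -[RHS](continuous_rv_atomless x cW2); congr (P (_ @^-1` _)).
by apply/seteqP; split=> z; rewrite /xsection/= inE /D/=.
Qed.

End continuous_cdf.

(** * Measurability of the estimated utilities *)

Lemma measurable_natr_bool d (T : measurableType d) (R : realType)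
    (b : T -> bool) : measurable_fun setT b ->
  measurable_fun setT (fun w => (b w)%:R : R).
Proof.
by move=> mb; apply: (measurableT_comp (f := fun c : bool => c%:R : R)).
Qed.

(** The quantile enters [psi] only through its comparison with [y i], which [le_quantile_empirical]
    turns into finitely many comparisons between observations. *)
Lemma measurable_psi_quantile d (T : measurableType d) (R : realType)
    (n : nat) (y : 'I_n -> T -> R) (tau : R) (i : 'I_n) : 0 < tau <= 1 ->
    (forall k, measurable_fun setT (y k)) ->
  measurable_fun setT (fun w =>
    psi tau (y i w - quantile (empirical_cdf (fun k => y k w)) tau)).
Proof.
move=> t01 my.
rewrite (_ : (fun _ => _) = fun w => tau -
    (n%:R^-1 * \sum_(k < n) (y k w < y i w)%R%:R < tau)%R%:R); last first.
  apply/funext => w; rewrite /psi subr_le0.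
  by rewrite (le_quantile_empirical (fun k => y k w)).
apply: measurable_funB => //; apply: measurable_natr_bool.
apply: measurable_fun_ltr => //; apply: measurable_funM => //.
by apply: measurable_sum => k; apply: measurable_natr_bool;
  exact: measurable_fun_ltr.
Qed.

Lemma measurable_utility_hat d (T : measurableType d) (R : realType)
    (P : probability T R) (tau iota : R) (n p : nat)
    (Ys : 'I_n -> {RV P >-> R}) (Xs : 'I_n -> 'I_p -> {RV P >-> R}) (j : 'I_p) :
  0 < tau < 1 -> 0 < iota < 1 ->
  measurable_fun setT (utility_hat tau iota Ys Xs j).
Proof.
move=> /andP[t0 t1] /andP[i0 i1].
apply: measurableT_comp; first exact: normr_measurable.
apply: measurable_funM => //; apply: measurable_funM => //.
apply: measurable_sum => i; apply: measurable_funM.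
  apply: (measurable_psi_quantile (y := fun k => Ys k)) => //.
  by rewrite t0 ltW.
apply: (measurable_psi_quantile (y := fun k => Xs k j)) => //.
by rewrite i0 ltW.
Qed.

(** Links the averages in the empirical cdfs with the centred sums in the tail bounds. *)
Lemma mean_deviation (R : realType) (n : nat) (a : 'I_n -> R) (m : R) :
  (0 < n)%N ->
  `|n%:R^-1 * \sum_(i < n) a i - m| * n%:R = `|\sum_(i < n) (a i - m)|.
Proof.
move=> n0; have nN0 : n%:R != 0 :> R by rewrite pnatr_eq0 -lt0n.
rewrite -[X in _ * X]ger0_norm// -normrM sumrB sumr_const card_ord -mulr_natr.
by congr (`|_|); field.
Qed.

(** * Real coordinates of an i.i.d. sample: common cdf, pairwise independence, ties *)

Section marginals.
Context d d' (T : measurableType d) (E : measurableType d') (R : realType).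
Variables (P : probability T R) (n : nat) (Z : 'I_n -> T -> E) (Z0 : T -> E).
Hypothesis indZ : mutually_independent P Z.
Hypothesis idZ : forall i, identically_distributed P (Z i) Z0.
Variables (f : E -> R) (mf : measurable_fun setT f).
Variables (W : 'I_n -> {RV P >-> R}) (W0 : {RV P >-> R}).
Hypothesis WE : forall i w, W i w = f (Z i w).
Hypothesis W0E : forall w, W0 w = f (Z0 w).

Let mfA A : measurable A -> measurable (f @^-1` A).
Proof. by move=> mA; rewrite -[X in measurable X]setTI; exact: mf. Qed.

Let WA i A : W i @^-1` A = Z i @^-1` (f @^-1` A).
Proof. by apply/seteqP; split => w /=; rewrite WE. Qed.

Lemma rcdf_marginal i : rcdf (W i) = rcdf W0.
Proof.
apply/funext => x; apply: EFin_inj; rewrite -!rcdf_EFin WA idZ.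
  by congr (P _); apply/seteqP; split => w /=; rewrite W0E.
exact: mfA.
Qed.

Lemma independent_marginals i k (A B : set R) : i != k ->
    measurable A -> measurable B ->
  P (W i @^-1` A `&` W k @^-1` B) = (P (W i @^-1` A) * P (W k @^-1` B))%E.
Proof.
move=> ik mA mB.
(* Mutual independence takes a family over all indices; with the subset [[set i; k]] only its values
   at [i] and [k] matter. *)
pose S l := if l == i then f @^-1` A else f @^-1` B.
have mS l : measurable (S l) by rewrite /S; case: ifP => _; exact: mfA.
have := indZ [set i; k]%SET mS.
rewrite big_setU1 ?inE// big_set1 /S eqxx eq_sym (negbTE ik) !WA => <-.
congr (P _); apply/seteqP; split => w /=.
  move=> [wA wB] l /=; rewrite !inE => /orP[]/eqP ->; rewrite ?eqxx//.
  by rewrite eq_sym (negbTE ik).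
move=> h; split.
  by have /= := h i; rewrite !inE eqxx/=; apply.
by have /= := h k; rewrite !inE eqxx orbT eq_sym (negbTE ik)/=; apply.
Qed.

(** Written as a finite union so that measurability and nullity reduce to single pairs. *)
Definition ties : set T :=
  \big[setU/set0]_(ik : 'I_n * 'I_n | ik.1 != ik.2)
    [set w | W ik.1 w = W ik.2 w].

Let measurable_tie i k : measurable [set w | W i w = W k w].
Proof.
rewrite (_ : [set _ | _] = (fun w => W i w == W k w) @^-1` [set true]).
  rewrite -[X in measurable X]setTI.
  by apply: measurable_fun_eqr => //; exact: measurable_funPT.
by apply/seteqP; split=> w /= /eqP.
Qed.

Lemma measurable_ties : measurable ties.
Proof. by apply: bigsetU_measurable => ik _; exact: measurable_tie. Qed.

Lemma ties_null : continuous_rv W0 -> P ties = 0%E.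
Proof.
move=> cW; apply/eqP; rewrite eq_le measure_ge0 andbT.
apply: le_trans (measure_bigsetU_le P _ _ _) _ => [ik|].
  exact: measurable_tie.
rewrite big1// => ik ne; apply: independent_ties_null.
  by rewrite /continuous_rv rcdf_marginal.
by move=> A B mA mB; exact: independent_marginals.
Qed.

Lemma not_ties_injective w : ~ ties w -> injective (fun i => W i w).
Proof.
move=> tw i k ikw; apply/eqP/negPn/negP => ik; apply: tw.
rewrite /ties -bigcup_seq_cond/=; exists (i, k) => //=.
by rewrite mem_index_enum.
Qed.

End marginals.

(** * Exponential bound for the utility of one predictor *)

Section utility_deviation.
Context d (T : measurableType d) (R : realType) (P : probability T R).
Variables (tau iota : R) (htau : 0 < tau < 1) (hiota : 0 < iota < 1).
Variables (n p : nat) (n_gt0 : (0 < n)%N).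
Variables (Y : {RV P >-> R}) (X : 'I_p -> {RV P >-> R}).
Variables (Ys : 'I_n -> {RV P >-> R}) (Xs : 'I_n -> 'I_p -> {RV P >-> R}).
Hypothesis iid : iid_copies Y X Ys Xs.
Hypothesis Y_cont : continuous_rv Y.
Variable j : 'I_p.
Hypothesis X_cont : continuous_rv (X j).

Let sd := Num.sqrt (tau * (1 - tau) * iota * (1 - iota)).
Let Z i := response_covariates (Ys i) (Xs i).
Let Z0 := response_covariates Y X.
Let indZ : mutually_independent P Z. Proof. exact: iid.1. Qed.
Let idZ i : identically_distributed P (Z i) Z0.
Proof. exact: iid.2. Qed.

Let snd_j (z : R * p.-tuple R) := tnth z.2 j.

Let measurable_snd_j : measurable_fun setT snd_j.
Proof.
apply: (measurableT_comp (f := fun t : p.-tuple R => tnth t j)) => //.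
exact: measurable_tnth.
Qed.

Let measurable_Z i : measurable_fun setT (Z i).
Proof.
apply: measurable_fun_pair => //; apply/measurable_fun_tnthP => l.
rewrite (_ : _ \o _ = Xs i l)//.
by apply/funext => w /=; rewrite tnth_mktuple.
Qed.

Let snd_jE i w : Xs i j w = snd_j (Z i w).
Proof. by rewrite /snd_j tnth_mktuple. Qed.

Let snd_jE0 w : X j w = snd_j (Z0 w).
Proof. by rewrite /snd_j tnth_mktuple. Qed.

Let tiesY := ties Ys.
Let tiesX := ties (fun i => Xs i j).

Let measurable_tiesY : measurable tiesY. Proof. exact: measurable_ties. Qed.

Let measurable_tiesX : measurable tiesX. Proof. exact: measurable_ties. Qed.

Let tiesY_null : P tiesY = 0%E.
Proof. exact: (ties_null indZ idZ (f := fst) measurable_fst (W0 := Y)). Qed.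

Let tiesX_null : P tiesX = 0%E.
Proof. exact: (ties_null indZ idZ measurable_snd_j _ snd_jE0). Qed.

Let q := quantile (rcdf Y) tau.
Let qj := quantile (rcdf (X j)) iota.
Let B1 : set (R * p.-tuple R) := fst @^-1` `]-oo, q].
Let B2 : set (R * p.-tuple R) := snd_j @^-1` `]-oo, qj].

Let mB1 : measurable B1.
Proof. by rewrite -[X in measurable X]setTI; exact: measurable_fst. Qed.

Let mB2 : measurable B2.
Proof. by rewrite -[X in measurable X]setTI; exact: measurable_snd_j. Qed.

(** Continuity of the cdf makes the level exact, so deviations about [tau] are centred. *)
Let P_B1 i : P (Z i @^-1` B1) = tau%:E.
Proof. by rewrite idZ// -(rcdf_quantile Y_cont htau) -rcdf_EFin. Qed.

Let P_B2 i : P (Z i @^-1` B2) = iota%:E.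
Proof.
rewrite idZ// -(rcdf_quantile X_cont hiota) -rcdf_EFin; congr (P _).
by apply/seteqP; split => w; rewrite /B2/= -snd_jE0.
Qed.

Let joint := joint_cdf Y (X j) q qj.

Let Z0_B12E : Z0 @^-1` (B1 `&` B2) = [set w | Y w <= q /\ X j w <= qj].
Proof.
by apply/seteqP; split => w; rewrite /B1 /B2/= -snd_jE0 !in_itv.
Qed.

Let P_B12 i : P (Z i @^-1` (B1 `&` B2)) = joint%:E.
Proof.
rewrite idZ; last exact: measurableI.
rewrite Z0_B12E fineK// fin_num_measure//.
rewrite (_ : [set _ | _] = Y @^-1` `]-oo, q] `&` X j @^-1` `]-oo, qj]).
  by apply: measurableI; rewrite -[X in measurable X]setTI;
    exact: measurable_funPT.
by apply/seteqP; split => w; rewrite /= !in_itv.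
Qed.

Let joint_itv : 0 <= joint <= 1.
Proof.
rewrite -!lee_fin -(P_B12 (Ordinal n_gt0)) measure_ge0 probability_le1//.
by rewrite -[X in measurable X]setTI; apply: measurable_Z => //;
  exact: measurableI.
Qed.

Let dev (B : set (R * p.-tuple R)) (m eps : R) : set T :=
  [set w | eps * n%:R <= `|\sum_(i < n) (\1_B (Z i w) - m)|].

Let measurable_dev B m eps : measurable B -> measurable (dev B m eps).
Proof.
move=> mB; apply: measurable_superlevel.
apply: measurableT_comp; first exact: normr_measurable.
apply: measurable_sum => i; apply: measurable_funB => //.
by apply: measurableT_comp => //; exact: measurable_indic.
Qed.

Let not_dev B m eps w (b : 'I_n -> bool) :
  (forall i, \1_B (Z i w) = (b i)%:R :> R) -> ~ dev B m eps w ->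
  `|n%:R^-1 * \sum_(i < n) (b i)%:R - m| < eps.
Proof.
move=> Bb /negP; rewrite -ltNge.
under eq_bigr do rewrite Bb.
by rewrite -mean_deviation// ltr_pM2r// ltr0n.
Qed.

(** Off these events there are no ties and the three frequencies are within [eps] of their means, so
    [copula_moment_dist] keeps the numerator error strictly below [3 eps + 4/n]. *)
Lemma utility_deviation_cover eps w :
  3 * eps + 4 * n%:R^-1 <=
    sd * `|utility_hat tau iota Ys Xs j w - utility tau iota Y X j| ->
  (tiesY `|` tiesX `|` (dev B1 tau eps `|` dev B2 iota eps `|`
    dev (B1 `&` B2) joint eps)) w.
Proof.
move=> big; apply: contrapT => /not_orP[/not_orP[nY nX]].
move=> /not_orP[/not_orP[d1 d2] d12].
have sd0 : 0 < sd.
  by move: htau hiota => /andP[? ?] /andP[? ?];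
    rewrite sqrtr_gt0 !mulr_gt0// subr_gt0.
have := copula_moment_dist q qj joint n_gt0 htau hiota
  (not_ties_injective nY) (not_ties_injective nX).
have h1 : `|empirical_cdf (fun i => Ys i w) q - tau| < eps.
  apply: not_dev d1 => i; rewrite indicE; congr ((nat_of_bool _)%:R).
  by apply/idP/idP; rewrite inE /B1/= in_itv.
have h2 : `|empirical_cdf (fun i => Xs i j w) qj - iota| < eps.
  apply: not_dev d2 => i; rewrite indicE; congr ((nat_of_bool _)%:R).
  by apply/idP/idP; rewrite inE /B2/= in_itv/= snd_jE.
have h3 : `|empirical_joint_cdf (fun i => Ys i w) (fun i => Xs i j w) q qj
    - joint| < eps.
  apply: not_dev d12 => i; rewrite indicE; congr ((nat_of_bool _)%:R).
  by apply/idP/andP; rewrite inE /B1 /B2/= !in_itv/= -snd_jE.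
move: big; rewrite /utility_hat /utility /copula_corr_hat /copula_corr.
rewrite -/sd -/q -/qj -/joint.
set Nh := n%:R^-1 * \sum_(i < n) _; set N := joint - _ => big hN.
(* The reverse triangle inequality passes from correlations to their absolute values, and [sd]
   cancels the common denominator. *)
have : sd * `| `|Nh / sd| - `|N / sd| | <= `|Nh - N|.
  apply: (@le_trans _ _ (sd * `|Nh / sd - N / sd|)).
    by apply: ler_wpM2l; [exact: ltW|exact: ler_dist_dist].
  by rewrite -mulrBl normrM normfV (gtr0_norm sd0) mulrCA mulfV ?mulr1// gt_eqF.
lra.
Qed.

Lemma measurable_utility_deviation c : measurable
  [set w | c <= `|utility_hat tau iota Ys Xs j w - utility tau iota Y X j|].
Proof.
apply: measurable_superlevel.
apply: measurableT_comp; first exact: normr_measurable.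
by apply: measurable_funB => //; exact: measurable_utility_hat.
Qed.

(** In the cover above the tie events are null, and each of the three deviation events contributes a
    two-sided bound with factor 2. *)
Lemma utility_deviation eps c : 0 < eps <= 2 ->
    3 * eps + 4 * n%:R^-1 <= sd * c ->
  (P [set w | (c <=
      `|utility_hat tau iota Ys Xs j w - utility tau iota Y X j|)%R]
   <= (6 * expR (- (eps ^+ 2 / 8) * n%:R))%:E)%E.
Proof.
move=> e02 ec.
have mB12 : measurable (B1 `&` B2) by exact: measurableI.
have m1 := measurable_dev tau eps mB1.
have m2 := measurable_dev iota eps mB2.
have m12 := measurable_dev joint eps mB12.
have sd0 : 0 <= sd by exact: sqrtr_ge0.
apply: (@le_trans _ _ (P (tiesY `|` tiesX `|` (dev B1 tau eps `|`
    dev B2 iota eps `|` dev (B1 `&` B2) joint eps)))).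
  apply: le_measure; rewrite ?inE.
  - exact: measurable_utility_deviation.
  - by apply: measurableU; apply: measurableU => //; exact: measurableU.
  move=> w /= cw; apply: utility_deviation_cover.
  by apply: le_trans ec _; exact: ler_wpM2l.
apply: le_trans (measureU2 P _ _) _.
- exact: measurableU.
- by apply: measurableU => //; exact: measurableU.
have Y0 : (P tiesY <= 0)%E by rewrite tiesY_null.
have X0 : (P tiesX <= 0)%E by rewrite tiesX_null.
rewrite -[leRHS]add0e; apply: leeD.
  apply: le_trans (measureU2 P measurable_tiesY measurable_tiesX) _.
  by rewrite -[leRHS]adde0; exact: leeD.
apply: le_trans (measureU2 P _ m12) _; first exact: measurableU.
have tau01 : 0 <= tau <= 1 by case/andP: htau => *; rewrite !ltW.
have iota01 : 0 <= iota <= 1 by case/andP: hiota => *; rewrite !ltW.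
rewrite (_ : 6 * expR _ = 2 * expR (- (eps ^+ 2 / 8) * n%:R) +
  2 * expR (- (eps ^+ 2 / 8) * n%:R) + 2 * expR (- (eps ^+ 2 / 8) * n%:R));
  last by ring.
rewrite !EFinD; apply: leeD; last exact: empirical_deviation.
apply: le_trans (measureU2 P m1 m2) _.
by apply: leeD; exact: empirical_deviation.
Qed.

End utility_deviation.

(** * Choice of the deviation level as a power of the sample size *)

Section rates.
Variable R : realType.

Lemma powRN_near (a c : R) : 0 < a -> 0 < c ->
  \forall n \near \oo, n%:R `^ (- a) <= c.
Proof.
move=> a0 c0; near=> n.
have n0 : 0 < n%:R :> R by rewrite ltr0n; near: n; exists 1%N.
rewrite powRN -[leRHS]invrK lef_pV2 ?posrE ?invr_gt0 ?powR_gt0//.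
(* Writing [c^-1] as a power with exponent [a] reduces the claim, by monotonicity, to [n] exceeding
   a fixed real. *)
have -> : c^-1 = (c^-1 `^ a^-1) `^ a.
  by rewrite -powRrM mulVf ?lt0r_neq0// powRr1// invr_ge0 ltW.
apply: ge0_ler_powR; rewrite ?nnegrE ?powR_ge0 ?ler0n ?ltW//.
near: n; exact: nbhs_infty_gtr.
Unshelve. all: by end_near. Qed.

(* The first alternative covers [kappa >= 1/2], where the bound exceeds 1 for
   small [c1]. *)
Lemma deviation_rate (s C kappa : R) : 0 < s -> 0 < C -> 0 < kappa ->
  exists2 c1 : R, 0 < c1 & \forall n \near \oo,
    1 <= 6 * expR (- c1 * n%:R `^ (1 - 2 * kappa)) \/
    exists eps : R, [/\ 0 < eps <= 2,
      3 * eps + 4 * n%:R^-1 <= s * (C * n%:R `^ (- kappa)) &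
      eps ^+ 2 / 8 * n%:R = c1 * n%:R `^ (1 - 2 * kappa)].
Proof.
move=> s0 C0 k0; have [k12|k12] := ltP kappa (1 / 2); last first.
  (* Here the exponent [1 - 2 kappa] is nonpositive, so the power of [n] is at most 1 and the
     exponential is at least [1 - 1/2]. *)
  exists (1 / 2); first lra.
  near=> n; left.
  have n1 : 1 <= n%:R :> R by rewrite ler1n; near: n; exists 1%N.
  have : n%:R `^ (1 - 2 * kappa) <= 1 :> R.
    by rewrite -[leRHS](powRr0 n%:R) ler_powR//; lra.
  have := expR_ge1Dx (- (1 / 2) * n%:R `^ (1 - 2 * kappa) : R).
  lra.
(* With [eps] equal to [e] times the power [- kappa] of [n], the term [3 eps] uses half of the
   budget [s C] times that power. The other half absorbs [4/n] once the power [- (1 - kappa)] of [n]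
   is at most [3 e / 4]; [eps <= 2] holds once the power [- kappa] is at most [2 / e]. *)
pose e := s * C / 6.
have e0 : 0 < e by rewrite divr_gt0// mulr_gt0.
exists (e ^+ 2 / 8); first by rewrite divr_gt0// exprn_gt0.
have e20 : 0 < 2 / e by rewrite divr_gt0.
have e34 : 0 < e * 3 / 4 by rewrite divr_gt0// mulr_gt0.
have k10 : 0 < 1 - kappa by lra.
near=> n; right.
have n0 : 0 < n%:R :> R by rewrite ltr0n; near: n; exists 1%N.
have nN0 := lt0r_neq0 n0.
have nk0 : 0 < n%:R `^ (- kappa) :> R by exact: powR_gt0.
exists (e * n%:R `^ (- kappa)); split.
- rewrite mulr_gt0//= mulrC -ler_pdivlMr//.
  by near: n; exact: powRN_near.
- have h : n%:R `^ (- (1 - kappa)) <= e * 3 / 4.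
    by near: n; exact: powRN_near.
  have -> : n%:R^-1 = n%:R `^ (- kappa) * n%:R `^ (- (1 - kappa)) :> R.
    rewrite -powRD ?nN0 ?implybT// -powR_inv1 ?ltW//; congr (_ `^ _); ring.
  have := ler_wpM2l (ltW nk0) h; rewrite /e; lra.
- rewrite powRD ?nN0 ?implybT// powRr1 ?ltW//.
  have -> : n%:R `^ (- (2 * kappa)) = (n%:R `^ (- kappa)) ^+ 2 :> R.
    by rewrite -powR_mulrn ?ltW// -powRrM; congr (_ `^ _); ring.
  field.
Unshelve. all: by end_near. Qed.

End rates.

(** * Union bounds over all predictors, then over the active ones *)

Theorem theorem2p3 (R : realType) (tau iota kappa : R)
    (htau : 0 < tau < 1) (hiota : 0 < iota < 1) (hkappa : 0 < kappa)
    (p : nat -> nat) (d : nat -> measure_display)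
    (T : forall n : nat, measurableType (d n))
    (P : forall n : nat, probability (T n) R)
    (Y : forall n : nat, {RV (P n) >-> R})
    (X : forall n : nat, 'I_(p n) -> {RV (P n) >-> R})
    (Ys : forall n : nat, 'I_n -> {RV (P n) >-> R})
    (Xs : forall n : nat, 'I_n -> 'I_(p n) -> {RV (P n) >-> R})
    (Ycont : forall n : nat, continuous_rv (Y n))
    (Xcont : forall (n : nat) (j : 'I_(p n)), continuous_rv (X n j))
    (iid : forall n : nat, iid_copies (Y n) (X n) (Ys n) (Xs n))
    (C1_density : exists r m M D : R, [/\ 0 < r, 0 < m &
       forall n : nat,
         regular_density_near_quantile r m M D tau (Y n) /\
         forall j : 'I_(p n),
           regular_density_near_quantile r m M D iota (X n j)]) :
  (forall C : R, 0 < C ->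
     exists2 c1 : R, 0 < c1 &
       \forall n \near \oo,
         (P n [set w | (C * n%:R `^ (- kappa) <=
                 \big[Num.max/0]_(j < p n)
                   `|utility_hat tau iota (Ys n) (Xs n) j w
                     - utility tau iota (Y n) (X n) j|)%R]
          <= (6 * (p n)%:R * expR (- c1 * n%:R `^ (1 - 2 * kappa)))%:E)%E)
  /\
  (forall C0 C1 : R, 0 < C0 -> C1 <= C0 / 2 ->
     (forall (n : nat) (j : 'I_(p n)),
        j \in active_set tau iota (Y n) (X n) ->
        C0 * n%:R `^ (- kappa) <= utility tau iota (Y n) (X n) j) ->
     exists2 c1 : R, 0 < c1 &
       \forall n \near \oo,
         ((1 - 6 * #|active_set tau iota (Y n) (X n)|%:R
               * expR (- c1 * n%:R `^ (1 - 2 * kappa)))%:E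
          <= P n [set w | active_set tau iota (Y n) (X n) \subset
                  screened_set tau iota (C1 * n%:R `^ (- kappa))
                    (Ys n) (Xs n) w])%E).
Proof.
have sd0 : 0 < Num.sqrt (tau * (1 - tau) * iota * (1 - iota)).
  by move: htau hiota => /andP[? ?] /andP[? ?];
    rewrite sqrtr_gt0 !mulr_gt0// subr_gt0.
(* Both [c1] and the rank from which the bound holds are uniform in [j], as a union bound over [p n]
   predictors requires. *)
have tail C : 0 < C -> exists2 c1 : R, 0 < c1 & \forall n \near \oo,
    forall j : 'I_(p n),
    (P n [set w | (C * n%:R `^ (- kappa) <=
        `|utility_hat tau iota (Ys n) (Xs n) j w
          - utility tau iota (Y n) (X n) j|)%R]
     <= (6 * expR (- c1 * n%:R `^ (1 - 2 * kappa)))%:E)%E.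
  move=> C0; have [c1 c10 c1P] := deviation_rate sd0 C0 hkappa.
  exists c1 => //; apply: filterS2 c1P (nbhs_infty_gt 0%N).
  move=> n rate n0 j; case: rate => [h|[eps [e02 h epsE]]].
    apply: le_trans (probability_le1 _ _) _; last by rewrite lee_fin.
    exact: measurable_utility_deviation.
  rewrite mulNr -epsE -mulNr; exact: (utility_deviation htau hiota n0 (iid n)).
split=> [C C0|C0 C1 C00 C10 minC].
  have [c1 c10 c1P] := tail C C0; exists c1 => //.
  apply: filterS2 c1P (nbhs_infty_gt 0%N) => n bound n0.
  set S := [set w | _].
  pose F j := [set w | C * n%:R `^ (- kappa) <=
    `|utility_hat tau iota (Ys n) (Xs n) j w
      - utility tau iota (Y n) (X n) j|].
  have mF j : measurable (F j) by exact: measurable_utility_deviation.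
  (* If every deviation is below the threshold, so is the maximum; its default value 0 is below as
     well, the threshold being positive. *)
  have SF w : S w -> exists2 j, xpredT j & F j w.
    move=> Sw; apply: contrapT => nF; move: Sw; rewrite /S/= leNgt => /negP.
    apply; elim/big_ind : _ => [|x y xC yC|j _].
    - by rewrite mulr_gt0// powR_gt0// ltr0n.
    - by rewrite gt_max xC.
    - by rewrite ltNge; apply/negP => Fj; apply: nF; exists j.
  have mS : measurable S.
    rewrite (_ : S = \big[setU/set0]_j F j).
      exact: bigsetU_measurable.
    rewrite -bigcup_seq; apply/seteqP; split=> w /=.
      by move=> /SF[j _ Fj]; exists j => //=; rewrite mem_index_enum.
    by move=> [j _ Fj]; apply: le_trans Fj _; exact: le_bigmax.
  apply: le_trans (measure_fin_cover_le (P n) mS mF SF) _.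
  apply: (@le_trans _ _ (\sum_(j < p n)
      (6 * expR (- c1 * n%:R `^ (1 - 2 * kappa)))%:E)%E).
    by apply: lee_sum => j _; exact: bound.
  rewrite sumEFin lee_fin sumr_const card_ord -mulr_natr.
  by rewrite le_eqVlt; apply/orP; left; apply/eqP; ring.
(* [C0 / 2] is the least gap between the signal constant [C0] and a threshold constant
   [C1 <= C0 / 2]. *)
have C020 : 0 < C0 / 2 by rewrite divr_gt0.
have [c1 c10 c1P] := tail _ C020; exists c1 => //.
apply: filterS2 c1P (nbhs_infty_gt 0%N) => n bound n0.
set M := active_set _ _ _ _; set S := [set w | _].
pose F j := [set w | C0 / 2 * n%:R `^ (- kappa) <=
  `|utility_hat tau iota (Ys n) (Xs n) j w
    - utility tau iota (Y n) (X n) j|].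
have mF j : measurable (F j) by exact: measurable_utility_deviation.
have nk0 : 0 < n%:R `^ (- kappa) :> R by rewrite powR_gt0// ltr0n.
have mS : measurable S.
  rewrite (_ : S = \bigcap_(j in [set` M]) [set w |
      C1 * n%:R `^ (- kappa) <= utility_hat tau iota (Ys n) (Xs n) j w]).
    apply: fin_bigcap_measurable => // j _; apply: measurable_superlevel.
    exact: measurable_utility_hat.
  apply/seteqP; split=> w /=.
    by move=> /fintype.subsetP sub j /= /sub; rewrite inE.
  by move=> h; apply/fintype.subsetP => j /h/=; rewrite inE.
(* A missed active predictor has its true utility above [C0] and its estimate below [C1], in units
   of the power [- kappa] of [n], hence a deviation of at least half of [C0]. *)
have SF w : (~` S) w -> exists2 j, j \in M & F j w.
  move=> /= /negP/subsetPn[j jM jS]; exists j => //=.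
  have := minC n j jM; move: jS; rewrite inE -ltNge.
  have := ler_norm (utility tau iota (Y n) (X n) j
    - utility_hat tau iota (Ys n) (Xs n) j w).
  rewrite distrC /F/=; have := ler_wpM2r (ltW nk0) C10; lra.
have mSC : measurable (~` S) by exact: measurableC.
(* Only active predictors can be missed, so the union bound runs over [M] and yields its cardinality
   in place of [p n]. *)
have PS : (P n (~` S) <= \sum_(j in M) P n (F j))%E.
  exact: measure_fin_cover_le.
have {}PS : (1 - P n S <= (6 * #|M|%:R
    * expR (- c1 * n%:R `^ (1 - 2 * kappa)))%:E)%E.
  rewrite -probability_setC//; apply: le_trans PS _.
  apply: (@le_trans _ _ (\sum_(j in M)
      (6 * expR (- c1 * n%:R `^ (1 - 2 * kappa)))%:E)%E).
    by apply: lee_sum => j _; exact: bound.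
  rewrite sumEFin lee_fin sumr_const -mulr_natr.
  by rewrite le_eqVlt; apply/orP; left; apply/eqP; ring.
have fS : P n S \is a fin_num by rewrite fin_num_measure.
move: PS; rewrite -(fineK fS) -EFinB !lee_fin; lra.
Qed.
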